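(* Let $p$ be a prime, let $G$ be a finite $p$-group, and let $\mathsf{S}$ be a supercharacter theory of $G$. The following are equivalent: (1) the group $G$ is $\mathsf{S}$-nilpotent; (2) the degree of $\chi$ divides $|G|$ for every $\chi\in\mathrm{Ch}(\mathsf{S})$; (3) the size of $\mathrm{cl}_{\mathsf{S}}(g)$ divides $|G|$ for every $g\in G$.
   Context: Let $G$ be a finite group and $\mathrm{Irr}(G)$ its set of complex irreducible characters. A supercharacter theory $\mathsf{S}$ of $G$ is a pair $(\mathcal{X}_{\mathsf{S}},\mathcal{K}_{\mathsf{S}})$, where $\mathcal{X}_{\mathsf{S}}$ is a partition of $\mathrm{Irr}(G)$ and $\mathcal{K}_{\mathsf{S}}$ is a partition of $G$, such that $\{1\}\in\mathcal{K}_{\mathsf{S}}$, $|\mathcal{X}_{\mathsf{S}}|=|\mathcal{K}_{\mathsf{S}}|$, and for each $X\in\mathcal{X}_{\mathsf{S}}$ there is a (nonzero) character $\xi_X$ whose constituents lie in $X$ and which is constant on the parts of $\mathcal{K}_{\mathsf{S}}$. It is known that then every part of $\mathcal{K}_{\mathsf{S}}$ is a union of conjugacy classes, and $\xi_X$ is up to a scalar $\sigma_X=\sum_{\psi\in X}\psi(1)\psi$. The parts of $\mathcal{K}_{\mathsf{S}}$ are called $\mathsf{S}$-classes, $\mathrm{Cl}(\mathsf{S})$ is the set of them, and $\mathrm{cl}_{\mathsf{S}}(g)$ is the $\mathsf{S}$-class containing $g$. The characters $\sigma_X$, $X\in\mathcal{X}_{\mathsf{S}}$, are called $\mathsf{S}$-characters,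 and $\mathrm{Ch}(\mathsf{S})$ is the set of them. A subgroup $N\le G$ is $\mathsf{S}$-normal if it is a union of $\mathsf{S}$-classes. If $N$ is $\mathsf{S}$-normal, there is a (known) induced supercharacter theory $\mathsf{S}^{G/N}$ of $G/N$ whose classes are the images $\pi(K)$ of the $\mathsf{S}$-classes $K$ under the projection $\pi:G\to G/N$, and whose characters are the $\mathsf{S}$-characters containing $N$ in their kernel, viewed as characters of $G/N$. The subgroup $\mathbf{Z}(\mathsf{S})=\{g\in G:|\mathrm{cl}_{\mathsf{S}}(g)|=1\}$ is defined for every supercharacter theory. An $\mathsf{S}$-central series is a series $G=N_1\ge N_2\ge\dotsb\ge N_{r+1}=1$ of $\mathsf{S}$-normal subgroups with $N_i/N_{i+1}\le\mathbf{Z}(\mathsf{S}^{G/N_{i+1}})$ for all $1\le i\le r$. $G$ is $\mathsf{S}$-nilpotent if $G$ has an $\mathsf{S}$-central series. *)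

(* Defs.v *)
From HB Require Import structures.
From mathcomp Require Import all_boot all_order all_algebra all_fingroup.
From mathcomp Require Import all_solvable all_field all_character.

Set Implicit Arguments.
Unset Strict Implicit.
Unset Printing Implicit Defensive.

Import Order.TTheory GRing.Theory Num.Theory GroupScope.
Local Open Scope ring_scope.

(* The bare pair (X_S, K_S); the axioms are in is_supertheory. Irreducible     *)
(* characters are represented by their indices in Iirr G.                      *)
Record supertheory_data (gT : finGroupType) (G : {group gT}) :=
  SuperTheoryData {
    sct_chars : {set {set Iirr G}};
    sct_classes : {set {set gT}}
  }.

(* 0 \is a character holds in MathComp, hence the explicit xi != 0.            *)
Record is_supertheory (gT : finGroupType) (G : {group gT})
    (S : supertheory_data G) : Prop := IsSuperTheory {
  sct_chars_partition : partition (sct_chars S) [set: Iirr G];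
  sct_classes_partition : partition (sct_classes S) G;
  sct_class1 : [set 1%g] \in sct_classes S;
  sct_card : #|sct_chars S| = #|sct_classes S|;
  sct_charP : forall X : {set Iirr G}, X \in sct_chars S ->
    exists xi : 'CF(G),
      [/\ xi \is a character, xi != 0, {subset irr_constt xi <= X}
        & forall K : {set gT}, K \in sct_classes S ->
            {in K &, forall x y, xi x = xi y}]
}.

Definition sct_sigma (gT : finGroupType) (G : {group gT}) (X : {set Iirr G})
    : 'CF(G) :=
  \sum_(i in X) 'chi_i 1%g *: 'chi_i.

(* A sequence rather than a finite set, since 'CF(G) is not a finType.         *)
Definition sct_Ch (gT : finGroupType) (G : {group gT})
    (S : supertheory_data G) : seq 'CF(G) :=
  [seq sct_sigma X | X <- enum (sct_chars S)].

Definition sct_cl (gT : finGroupType) (G : {group gT})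
    (S : supertheory_data G) (g : gT) : {set gT} :=
  pblock (sct_classes S) g.

Definition sct_normal (gT : finGroupType) (G : {group gT})
    (S : supertheory_data G) (N : {group gT}) : Prop :=
  exists2 P : {set {set gT}}, P \subset sct_classes S & N = cover P :> {set gT}.

(* The theory S^{G/N}; meaningful when N is S-normal, which makes N normal in  *)
(* G. A part X is kept when N lies in the kernel of its S-character sigma_X,   *)
(* and its members are then replaced by the corresponding irreducible          *)
(* characters of G / N.                                                        *)
Definition sct_quotient (gT : finGroupType) (G : {group gT})
    (S : supertheory_data G) (N : {group gT}) : supertheory_data (G / N)%G :=
  SuperTheoryData
    [set (@quo_Iirr gT G N) @: X
       | X : {set Iirr G} in sct_chars S & N \subset cfker (sct_sigma X)]
    [set (K / N)%g | K : {set gT} in sct_classes S].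

Definition sct_center (gT : finGroupType) (G : {group gT})
    (S : supertheory_data G) : {set gT} :=
  [set g in G | #|sct_cl S g| == 1%N].

(* The series is N 1 >= ... >= N r.+1; the values of N elsewhere are ignored.  *)
Definition sct_central_series (gT : finGroupType) (G : {group gT})
    (S : supertheory_data G) (r : nat) (N : nat -> {group gT}) : Prop :=
  [/\ N 1%N = G, N r.+1 = 1%G,
      forall i : nat, (1 <= i <= r.+1)%N -> sct_normal S (N i)
    & forall i : nat, (1 <= i <= r)%N ->
        N i.+1 \subset N i /\
        (N i / N i.+1)%g \subset sct_center (sct_quotient S (N i.+1))].

Definition sct_nilpotent (gT : finGroupType) (G : {group gT})
    (S : supertheory_data G) : Prop :=
  exists (r : nat) (N : nat -> {group gT}), sct_central_series S r N.

(* Main.v *)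
Require Import Defs.
From HB Require Import structures.
From mathcomp Require Import all_boot all_order all_algebra all_fingroup.
From mathcomp Require Import all_solvable all_field all_character.

Set Implicit Arguments.
Unset Strict Implicit.
Unset Printing Implicit Defensive.

Import Order.TTheory GRing.Theory Num.Theory GroupScope.
Local Open Scope ring_scope.

(** Since G is a p-group, divisibility of |G| in (2) and (3) amounts to saying
    that the S-degrees sigma_X(1), respectively the sizes of the S-classes,
    are powers of p.

    Degrees against class sizes. Let d be the common number of S-classes and
    S-characters, Q the matrix (sigma_X(K)) and P the matrix
    (sum_(x in K) psi_X(x) / psi_X(1)), where psi_X is any member of X.
    Orthogonality gives Q diag(|K|) Q^* = |G| diag(sigma_X(1)) and
    P Q^* = |G| I. Both matrices have algebraic integer entries (for P because
    every S-class is a union of conjugacy classes), so that |det Q|^2 and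
    |det P|^2 are algebraic integers; they are also the rational numbers
    |G|^d prod sigma_X(1) / prod |K| and |G|^d prod |K| / prod sigma_X(1).
    Hence each of the two products divides |G|^d times the other
    ([sct_prod_class_dvd], [sct_prod_degree_dvd]), and all the factors of one
    are powers of p exactly when those of the other are. This is the argument
    of Frame for commutative association schemes.

    Class sizes against nilpotency. Functions constant on S-classes are closed
    under convolution, so products of unions of S-classes are unions of
    S-classes, and for a union N of S-classes that is a subgroup the sets
    K N are the preimages of the classes of the theory on G / N; moreover
    |K N| |K :&: x N| = |K| |N| for x in K ([sct_mul_coset_count]).
    If all |K| are powers of p, the classes of every quotient have p-power
    size, and the usual count modulo p shows that the center of a nontrivial
    quotient is nontrivial ([center_mod_proper]): the upper central series
    reaches G. Conversely, if M / L is central in the theory on G / L, the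
    fibres of K L -> K M / M are cosets of the stabiliser of K L in M, a
    p-group; going down a central series from K G = G to K 1 = K, every
    |K N_i| is thus a power of p ([pnat_cl_of_sct_nilpotent]).

    The implication (1) -> (2) is obtained through (3). *)

(** * Supercharacters span the functions constant on superclasses *)

Section Supercharacters.

Variables (gT : finGroupType) (G : {group gT}) (S : supertheory_data G).
Hypothesis sctS : is_supertheory S.

Let tiK : trivIset (sct_classes S).
Proof. by case/and3P: (sct_classes_partition sctS). Qed.

Let covK : cover (sct_classes S) = G.
Proof. by case/and3P: (sct_classes_partition sctS) => /eqP. Qed.

Lemma mem_sct_cl x : (x \in sct_cl S x) = (x \in G).
Proof. by rewrite mem_pblock covK. Qed.

Lemma sct_cl_mem x : x \in G -> sct_cl S x \in sct_classes S.
Proof. by move=> Gx; apply: pblock_mem; rewrite covK. Qed.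

Lemma sct_cl_def (K : {set gT}) x :
  K \in sct_classes S -> x \in K -> sct_cl S x = K.
Proof. exact: def_pblock. Qed.

Lemma sct_cl_eq x y : y \in sct_cl S x -> sct_cl S y = sct_cl S x.
Proof. exact: same_pblock. Qed.

Lemma sct_class_sub (K : {set gT}) : K \in sct_classes S -> K \subset G.
Proof. by move=> SK; rewrite -covK; apply: (bigcup_max K). Qed.

Lemma sct_cl_sub x : sct_cl S x \subset G.
Proof.
rewrite /sct_cl /pblock; case: pickP => [K /andP[SK _] | _] /=.
  exact: sct_class_sub.
exact: sub0set.
Qed.

Lemma sct_cl1 : sct_cl S 1%g = [set 1%g].
Proof. by apply: (sct_cl_def (sct_class1 sctS)); rewrite set11. Qed.

Lemma sct_class_repr (K : {set gT}) : K \in sct_classes S -> repr K \in K.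
Proof.
move=> SK; have [x Kx]: exists x, x \in K; last exact: mem_repr Kx.
by apply/set0Pn; case/and3P: (sct_classes_partition sctS) => _ _; apply: contraNneq => <-.
Qed.

Definition sct_invariant (f : gT -> algC) :=
  {in G, forall x, {in sct_cl S x, forall y, f y = f x}}.

(** Orthogonality makes the phi X linearly independent, and there are as many
    of them as there are S-classes: their table of values is invertible. The
    functions f are not assumed to be class functions, which is what allows
    the S-classes to be shown closed under conjugation later on. *)
Lemma sct_orthogonal_span (phi : {set Iirr G} -> 'CF(G)) (f : gT -> algC) :
    {in sct_chars S, forall X, sct_invariant (phi X)} ->
    {in sct_chars S, forall X, phi X != 0} ->
    {in sct_chars S &, forall X Y, X != Y -> '[phi X, phi Y] = 0} ->
    sct_invariant f ->
  exists a : {set Iirr G} -> algC,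
    {in G, forall x, f x = \sum_(X in sct_chars S) a X * phi X x}.
Proof.
move=> phiS phi0 phi_orth fS.
pose M := \matrix_(i < #|sct_chars S|, j < #|sct_classes S|)
            phi (enum_val i) (repr (enum_val j)).
have rowM (v : 'rV_#|sct_chars S|) (j : 'I_#|sct_classes S|) (x : gT) :
    x \in enum_val j -> (v *m M) 0 j = (\sum_i v 0 i *: phi (enum_val i)) x.
  move=> jx; rewrite mxE sum_cfunE; apply: eq_bigr => i _.
  have Gx: x \in G by apply: subsetP jx; apply/sct_class_sub/enum_valP.
  rewrite mxE cfunE; congr (_ * _); apply: phiS (enum_valP i) _ Gx _ _.
  by rewrite (sct_cl_def (enum_valP j) jx); apply/sct_class_repr/enum_valP.
have classP x : x \in G -> exists j : 'I_#|sct_classes S|, x \in enum_val j.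
  move=> Gx; exists (enum_rank_in (sct_cl_mem Gx) (sct_cl S x)).
  by rewrite enum_rankK_in ?sct_cl_mem ?mem_sct_cl.
have freeM: row_free M.
  apply: inj_row_free => v vM0; apply/rowP => i.
  have sum0: \sum_i v 0 i *: phi (enum_val i) = 0.
    apply/cfun_inP => x Gx; have [j jx] := classP x Gx.
    by rewrite -(rowM v j) // vM0 !mxE cfunE.
  have := congr1 (cfdotr (phi (enum_val i))) sum0.
  rewrite /= cfdot0l cfdot_suml (bigD1 i) //= big1 => [|k ne_ki].
    rewrite cfdotZl addr0 mxE => /eqP.
    by rewrite mulf_eq0 cfnorm_eq0 (negPf (phi0 _ (enum_valP i))) orbF => /eqP.
  rewrite cfdotZl phi_orth ?mulr0 ?enum_valP //.
  by rewrite (inj_eq enum_val_inj).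
have fullM: row_full M by rewrite /row_full (eqP freeM) (sct_card sctS).
pose F := \row_(j < #|sct_classes S|) f (repr (enum_val j)).
have /submxP[v def_F] : (F <= M)%MS by apply: submx_full.
(* The coordinates in v are indexed by ordinals; the sum, which has exactly   *)
(* one term when X is a part, turns them into a function of X.                *)
exists (fun X => \sum_(i < #|sct_chars S| | enum_val i == X) v 0 i) => x Gx.
have [j jx] := classP x Gx.
transitivity (F 0 j).
  rewrite mxE; apply/esym/fS => //.
  by rewrite (sct_cl_def (enum_valP j) jx); apply/sct_class_repr/enum_valP.
rewrite def_F (rowM v j x jx) sum_cfunE [RHS]big_enum_val; apply: eq_bigr => i _.
rewrite cfunE (eq_bigl (pred1 i)) ?big_pred1_eq // => k.
by rewrite /= (inj_eq enum_val_inj).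
Qed.

Let disjX (X Y : {set Iirr G}) i :
  X \in sct_chars S -> Y \in sct_chars S -> i \in X -> i \in Y -> X = Y.
Proof.
move=> SX SY Xi Yi; case/and3P: (sct_chars_partition sctS) => _ tiX _.
by rewrite -(def_pblock tiX SX Xi) (def_pblock tiX SY Yi).
Qed.

Lemma cfdot_sct_sigma (X : {set Iirr G}) i :
  '[sct_sigma X, 'chi_i] = (i \in X)%:R * 'chi_i 1%g.
Proof.
rewrite cfdot_suml; have [Xi | X'i] := boolP (i \in X).
  rewrite (bigD1 i) //= big1 => [|j /andP[_ ne_ji]].
    by rewrite cfdotZl cfnorm_irr mulr1 addr0 mul1r.
  by rewrite cfdotZl cfdot_irr (negPf ne_ji) mulr0.
rewrite mul0r big1 // => j Xj; rewrite cfdotZl cfdot_irr.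
by case: eqP => [ji | _]; rewrite ?mulr0 //; rewrite -ji Xj in X'i.
Qed.

(** The regular character vanishes off the S-class [set 1], hence is a
    combination of the given characters xi_X; comparing the constituents in X
    identifies sigma_X, its X-component, with a multiple of xi_X. *)
Lemma sct_sigma_invariant (X : {set Iirr G}) :
  X \in sct_chars S -> sct_invariant (sct_sigma X).
Proof.
have /fin_all_exists[xi xiP] Y : exists xi : 'CF(G), Y \in sct_chars S ->
    [/\ sct_invariant xi, xi != 0 & {in [predC Y], forall i, '[xi, 'chi_i] = 0}].
  have [SY | ] := boolP (Y \in sct_chars S); last by exists 0.
  have [xi [_ xi0 Yxi xiS]] := sct_charP sctS SY.
  exists xi => _; split=> // [x Gx y Kx_y | i /= Y'i].
    by apply: (xiS _ (sct_cl_mem Gx)); rewrite ?mem_sct_cl.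
  apply: contraNeq Y'i => xi_i; apply: Yxi.
  by rewrite irr_consttE.
move=> SX.
have [||||a def_a] := @sct_orthogonal_span xi (cfReg G).
- by move=> Y /xiP[].
- by move=> Y /xiP[].
- move=> Y Z SY SZ neYZ; rewrite cfdot_sum_irr big1 // => i _.
  have [Yi | Y'i] := boolP (i \in Y); last first.
    by have [_ _ ->] := xiP Y SY; rewrite ?mul0r.
  have [_ _ ->] := xiP Z SZ; rewrite ?conjC0 ?mulr0 // inE.
  by apply: contra neYZ => Zi; apply/eqP; apply: disjX Yi Zi.
- move=> x Gx y Kxy; rewrite !cfRegE.
  have ->: (y == 1%g) = (x == 1%g) => //.
  apply/eqP/eqP=> [y1 | x1]; last first.
    by apply/set1P; rewrite -sct_cl1 -x1.
  by apply/set1P; rewrite -sct_cl1 -y1 (sct_cl_eq Kxy) mem_sct_cl.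
have {def_a}reg_a: cfReg G = \sum_(Y in sct_chars S) a Y *: xi Y.
  apply/cfun_inP => x Gx; rewrite def_a // sum_cfunE.
  by apply: eq_bigr => Y _; rewrite cfunE.
have ->: sct_sigma X = a X *: xi X.
  rewrite [LHS]cfun_sum_cfdot [RHS]cfun_sum_cfdot; apply: eq_bigr => i _.
  congr (_ *: _); rewrite cfdot_sct_sigma cfdotZl.
  have [Xi | X'i] := boolP (i \in X); last first.
    by have [_ _ ->] := xiP X SX; rewrite ?mul0r ?mulr0.
  have := congr1 (cfdotr 'chi_i) reg_a; rewrite /= cfReg_sum cfdot_suml.
  rewrite (bigD1 i) //= big1 => [|j ne_ji]; last first.
    by rewrite cfdotZl cfdot_irr (negPf ne_ji) mulr0.
  rewrite cfdotZl cfnorm_irr mulr1 addr0 mul1r => ->.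
  rewrite cfdot_suml (bigD1 X) //= big1 => [|Y /andP[SY neYX]].
    by rewrite cfdotZl addr0.
  have [_ _ xiY] := xiP Y SY; rewrite cfdotZl xiY ?mulr0 // inE.
  by apply: contra neYX => Yi; apply/eqP; apply: disjX Yi Xi.
move=> x Gx y Kxy; rewrite !cfunE; congr (_ * _).
by have [xiS _ _] := xiP X SX; apply: xiS.
Qed.

Lemma cfdot_sct_sigma2 (X Y : {set Iirr G}) :
    X \in sct_chars S -> Y \in sct_chars S ->
  '[sct_sigma X, sct_sigma Y] = (X == Y)%:R * sct_sigma X 1%g.
Proof.
move=> SX SY; rewrite [in LHS]cfdotC cfdot_suml rmorph_sum /=.
have [<-{Y SY} | neXY] := eqVneq.
  rewrite mul1r /sct_sigma sum_cfunE; apply: eq_bigr => i Xi.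
  rewrite cfdotZl rmorphM /= -cfdotC cfdot_sct_sigma Xi mul1r cfunE.
  by rewrite conj_natr ?Cnat_irr1.
rewrite mul0r big1 // => i Yi; rewrite cfdotZl rmorphM /= -cfdotC cfdot_sct_sigma.
case: (boolP (i \in X)) => [Xi | _]; last by rewrite mul0r mulr0.
by rewrite (disjX SX SY Xi Yi) eqxx in neXY.
Qed.

Lemma sct_sigma_char (X : {set Iirr G}) : sct_sigma X \is a character.
Proof.
apply: rpred_sum => i _; have /natrP[n ->] := Cnat_irr1 i.
by rewrite scaler_nat rpredMn ?irr_char.
Qed.

Lemma sct_sigma_neq0 (X : {set Iirr G}) :
  X \in sct_chars S -> sct_sigma X != 0.
Proof.
move=> SX; have /set0Pn[i Xi]: X != set0.
  by case/and3P: (sct_chars_partition sctS) => _ _; apply: contraNneq => <-.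
apply: contra_neq (irr1_neq0 i) => sX0; have := cfdot_sct_sigma X i.
by rewrite sX0 cfdot0l Xi mul1r.
Qed.

Lemma sct_invariant_span (f : gT -> algC) :
    sct_invariant f ->
  exists a : {set Iirr G} -> algC,
    {in G, forall x, f x = \sum_(X in sct_chars S) a X * sct_sigma X x}.
Proof.
apply: sct_orthogonal_span; first exact: sct_sigma_invariant.
  exact: sct_sigma_neq0.
by move=> X Y SX SY neXY; rewrite cfdot_sct_sigma2 // (negPf neXY) mul0r.
Qed.

End Supercharacters.
(** * Products of degrees and of class sizes *)

Section Frame.

Variables (gT : finGroupType) (G : {group gT}) (S : supertheory_data G).
Hypothesis sctS : is_supertheory S.

(** The indicator of an S-class is a combination of characters, thus a class
    function. *)
Lemma sct_cl_conj x y : x \in G -> y \in G -> (x ^ y)%g \in sct_cl S x.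
Proof.
move=> Gx Gy; pose f z : algC := (z \in sct_cl S x)%:R.
have fS: sct_invariant S f.
  move=> z Gz t Kzt; rewrite /f; congr (_%:R); congr nat_of_bool.
  apply/idP/idP=> [Kxt | Kxz].
    by rewrite -(sct_cl_eq sctS Kxt) (sct_cl_eq sctS Kzt) mem_sct_cl.
  by rewrite -(sct_cl_eq sctS Kxz).
have [a def_f] := sct_invariant_span sctS fS.
have: f (x ^ y)%g = f x.
  rewrite !def_f ?groupJ //; apply: eq_bigr => X _.
  by rewrite cfunJ.
rewrite /f (mem_sct_cl sctS) Gx => /eqP; rewrite eqr_nat.
by case: (_ \in _).
Qed.

Lemma Aint_det n (A : 'M[algC]_n) :
  (forall i j, A i j \in Aint) -> \det A \in Aint.
Proof.
move=> A_int; apply: rpred_sum => s _.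
by rewrite rpredMsign; apply: rpred_prod => i _.
Qed.

(** The sum is the value on the sum of K of the central character of 'chi_i,
    and K is a union of conjugacy classes. *)
Lemma Aint_sct_class_sum (K : {set gT}) i :
  K \in sct_classes S -> \sum_(x in K) 'chi[G]_i x / 'chi_i 1%g \in Aint.
Proof.
move=> SK; have sKG := sct_class_sub sctS SK.
pose F x : algC := if x \in K then 'chi_i x / 'chi_i 1%g else 0.
have KJ: {in G &, forall x y, ((x ^ y)%g \in K) = (x \in K)}.
  have sub x y : x \in G -> y \in G -> x \in K -> (x ^ y)%g \in K.
    by move=> Gx Gy Kx; rewrite -(sct_cl_def sctS SK Kx) sct_cl_conj.
  move=> x y Gx Gy; apply/idP/idP; last exact: sub.
  by rewrite -{2}(conjgK y x); apply: sub; rewrite ?groupJ ?groupV.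
have ->: \sum_(x in K) 'chi[G]_i x / 'chi_i 1%g = \sum_(x in G) F x.
  rewrite -big_mkcondr /=; apply: eq_bigl => x.
  by rewrite andbC; case: (boolP (x \in K)) => // /(subsetP sKG) ->.
rewrite sum_by_classes => [|x y Gx Gy]; last by rewrite /F KJ // cfunJ.
apply: rpred_sum => _ /imsetP[x Gx ->]; rewrite /F.
case: ifP => _; last by rewrite mulr0 rpred0.
have [y Gy ->] := repr_class G x.
by rewrite cfunJ // mulrA Aint_class_div_irr1.
Qed.

(* Parts of both partitions are numbered by the same ordinals, so that the   *)
(* tables below are square.                                                   *)
Let d := #|sct_classes S|.
Let X_ (i : 'I_d) : {set Iirr G} := enum_val (cast_ord (esym (sct_card sctS)) i).
Let K_ (j : 'I_d) : {set gT} := enum_val j.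

Let X_P i : X_ i \in sct_chars S. Proof. exact: enum_valP. Qed.

Let X_inj i j : (X_ i == X_ j) = (i == j).
Proof. by rewrite (inj_eq enum_val_inj) (inj_eq (@cast_ord_inj _ _ _)). Qed.

Let prodX (F : {set Iirr G} -> algC) :
  \prod_(X in sct_chars S) F X = \prod_i F (X_ i).
Proof.
rewrite big_enum_val; apply: reindex.
by exists (cast_ord (sct_card sctS)) => i _; rewrite ?cast_ordK ?cast_ordKV.
Qed.

Let sum_classes (h : gT -> algC) (phi : 'CF(G)) : sct_invariant S phi ->
  \sum_(j < d) (\sum_(x in K_ j) h x) * (phi (repr (K_ j)))^*
     = \sum_(x in G) h x * (phi x)^*.
Proof.
move=> phiS; rewrite (set_partition_big _ (sct_classes_partition sctS)) /=.
rewrite [RHS]big_enum_val; apply: eq_bigr => j _; rewrite mulr_suml.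
have SK := enum_valP j.
apply: eq_bigr => x Kx; congr (_ * _^*).
apply: phiS; first exact: subsetP (sct_class_sub sctS SK) x Kx.
by rewrite (sct_cl_def sctS SK Kx) (sct_class_repr sctS SK).
Qed.

Let psi (i : 'I_d) : Iirr G := odflt 0 [pick k in X_ i].

Let psi_in i : psi i \in X_ i.
Proof.
rewrite /psi; case: pickP => //= X0.
case/and3P: (sct_chars_partition sctS) => _ _ /negP[].
suff <-: X_ i = set0 by [].
by apply/setP => k; rewrite X0 inE.
Qed.

Let psiE i j : (psi i \in X_ j) = (i == j).
Proof.
have [<- | neij] := eqVneq; first exact: psi_in.
apply/negP=> Xj; case/eqP: neij; apply/eqP; rewrite -X_inj; apply/eqP.
case/and3P: (sct_chars_partition sctS) => _ tiX _.
by rewrite -(def_pblock tiX _ (psi_in i)) ?(def_pblock tiX _ Xj).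
Qed.

Let n : algC := #|G|%:R.
Let n_neq0 : n != 0. Proof. exact: neq0CG. Qed.

Let dot_sum (phi chi : 'CF(G)) :
  \sum_(x in G) phi x * (chi x)^* = n * '[phi, chi].
Proof. by rewrite cfdotE mulVKf. Qed.

Let Q := \matrix_(i < d, j < d) sct_sigma (X_ i) (repr (K_ j)).
Let P := \matrix_(i < d, j < d)
  \sum_(x in K_ j) 'chi_(psi i) x / 'chi_(psi i) 1%g.
Let Qc := (map_mx Num.conj Q)^T.
Let D := diag_mx (\row_j #|K_ j|%:R : 'rV[algC]_d).
Let E := diag_mx (\row_i (sct_sigma (X_ i) 1%g) : 'rV[algC]_d).

Let Q_orth : Q *m D *m Qc = n *: E.
Proof.
apply/matrixP => i k; rewrite mul_mx_diag !mxE.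
have := cfdot_sct_sigma2 sctS (X_P i) (X_P k).
rewrite X_inj mulr_natl => <-; rewrite -dot_sum.
rewrite -sum_classes; last exact: sct_sigma_invariant.
apply: eq_bigr => j _; rewrite !mxE; congr (_ * _).
have SK := enum_valP j.
rewrite mulr_natr -sumr_const; apply: eq_bigr => x Kx.
apply: (sct_sigma_invariant sctS (X_P i)).
  exact: subsetP (sct_class_sub sctS SK) x Kx.
by rewrite (sct_cl_def sctS SK Kx) (sct_class_repr sctS SK).
Qed.

Let P_orth : P *m Qc = n%:M.
Proof.
apply/matrixP => i k; rewrite !mxE.
under eq_bigr do rewrite !mxE.
rewrite sum_classes; last exact: sct_sigma_invariant.
under eq_bigr do rewrite mulrAC.
rewrite -mulr_suml dot_sum cfdotC cfdot_sct_sigma psiE rmorphM /=.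
rewrite !conj_natr ?natr_nat ?Cnat_irr1 // mulrA mulfK ?irr1_neq0 //.
by rewrite mulr_natr.
Qed.

Let det_Qc : \det Qc = (\det Q)^*.
Proof. by rewrite det_tr det_map_mx. Qed.

Let det_eq1 : \det Q * (\det Q)^* * \prod_(K in sct_classes S) #|K|%:R
   = n ^+ d * \prod_(X in sct_chars S) sct_sigma X 1%g.
Proof.
have ->: \prod_(K in sct_classes S) #|K|%:R = \det D.
  by rewrite det_diag big_enum_val; apply: eq_bigr => j _; rewrite mxE.
have ->: \prod_(X in sct_chars S) sct_sigma X 1%g = \det E.
  by rewrite det_diag prodX; apply: eq_bigr => i _; rewrite mxE.
by rewrite -detZ -Q_orth !det_mulmx det_Qc mulrAC.
Qed.

Let det_eq2 : \det P * (\det Q)^* = n ^+ d.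
Proof. by rewrite -det_Qc -det_mulmx P_orth det_scalar. Qed.

Let AintQ : \det Q * (\det Q)^* \in Aint.
Proof.
rewrite rpredM ?Aint_aut //; apply: Aint_det => i j; rewrite mxE.
all: exact/Aint_char/sct_sigma_char.
Qed.

Let AintP : \det P * (\det P)^* \in Aint.
Proof.
have: \det P \in Aint.
  by apply: Aint_det => i j; rewrite mxE; apply/Aint_sct_class_sum/enum_valP.
by move=> intP; rewrite rpredM ?Aint_aut.
Qed.

Let prodK_nat : \prod_(K in sct_classes S) #|K|%:R \is a @Num.nat algC.
Proof. by apply: rpred_prod => K _; apply: natr_nat. Qed.

Let prodX_nat : \prod_(X in sct_chars S) sct_sigma X 1%g \is a Num.nat.
Proof. by apply: rpred_prod => X _; apply/Cnat_char1/sct_sigma_char. Qed.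

Let prodK0 : \prod_(K in sct_classes S) #|K|%:R != 0 :> algC.
Proof.
apply/prodf_neq0 => K SK; rewrite pnatr_eq0 -lt0n.
by apply/card_gt0P; exists (repr K); apply: sct_class_repr SK.
Qed.

Let prodX0 : \prod_(X in sct_chars S) sct_sigma X 1%g != 0.
Proof.
apply/prodf_neq0 => X SX; rewrite char1_eq0 ?sct_sigma_char //.
exact: (sct_sigma_neq0 sctS SX).
Qed.

Let Crat_quotient (x y : algC) :
  x \is a Num.nat -> y \is a Num.nat -> n ^+ d * x / y \in Crat.
Proof.
move=> /natrP[a ->] /natrP[b ->].
by rewrite rpred_div ?rpredM ?rpredX ?rpred_nat.
Qed.

(** The quotient is the squared modulus of det Q, an algebraic integer that is
    rational. *)
Lemma sct_prod_class_dvd :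
  (\prod_(K in sct_classes S) #|K|%:R %|
     #|G|%:R ^+ #|sct_classes S| * \prod_(X in sct_chars S) sct_sigma X 1%g)%C.
Proof.
apply/dvdCP; exists (\det Q * (\det Q)^*); last by rewrite det_eq1.
apply: Cint_rat_Aint; last by [apply: AintQ | apply: AintP].
rewrite -(mulfK prodK0 (\det Q * _)) det_eq1.
by apply: Crat_quotient.
Qed.

(** The quotient is the squared modulus of det P, since
    |det P|^2 |det Q|^2 = |G|^(2d). *)
Lemma sct_prod_degree_dvd :
  (\prod_(X in sct_chars S) sct_sigma X 1%g %|
     #|G|%:R ^+ #|sct_classes S| * \prod_(K in sct_classes S) #|K|%:R)%C.
Proof.
have key: \det P * (\det P)^* * \prod_(X in sct_chars S) sct_sigma X 1%g
            = n ^+ d * \prod_(K in sct_classes S) #|K|%:R.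
  apply: (mulfI (expf_neq0 d n_neq0)).
  rewrite mulrCA -det_eq1.
  transitivity ((\det P * (\det Q)^*) * (\det P * (\det Q)^*)^*
                  * \prod_(K in sct_classes S) #|K|%:R).
    by rewrite rmorphM /= conjCK mulrA [\det Q * _]mulrC mulrACA.
  by rewrite det_eq2 rmorphXn rmorph_nat mulrA.
apply/dvdCP; exists (\det P * (\det P)^*) => //.
apply: Cint_rat_Aint; last by [apply: AintQ | apply: AintP].
rewrite -(mulfK prodX0 (\det P * _)) key.
by apply: Crat_quotient.
Qed.

End Frame.
(** * Unions of superclasses and their products *)

Section ClosedSets.

Variables (gT : finGroupType) (G : {group gT}) (S : supertheory_data G).
Hypothesis sctS : is_supertheory S.

Lemma irr_convolution (i j : Iirr G) x :
  \sum_(y in G) 'chi_i y * 'chi_j (y^-1 * x)%g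
    = (i == j)%:R * (#|G|%:R * ('chi_i x / 'chi_i 1%g)).
Proof.
transitivity (\sum_(y in G) 'chi_j (y * x)%g * 'chi_i y^-1%g).
  rewrite (reindex_inj invg_inj) /=; apply: eq_big => y; first by rewrite groupV.
  by rewrite invgK mulrC.
have /(congr1 ( *%R #|G|%:R)) := generalized_orthogonality_relation x j i.
rewrite mulVKf ?neq0CG // => ->; rewrite mulrCA eq_sym.
by case: eqP => [-> | _]; rewrite ?mul0r.
Qed.

(** The sigma_X are, up to the factor |G|, orthogonal idempotents for
    convolution, so that their span is closed under it. *)
Lemma sct_invariant_convolution (f g : gT -> algC) :
    sct_invariant S f -> sct_invariant S g ->
  sct_invariant S (fun x => \sum_(y in G) f y * g (y^-1 * x)%g).
Proof.
move=> /(sct_invariant_span sctS)[a def_f] /(sct_invariant_span sctS)[b def_g].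
have sigma_conv X Y x : X \in sct_chars S -> Y \in sct_chars S ->
    \sum_(y in G) sct_sigma X y * sct_sigma Y (y^-1 * x)%g
      = (X == Y)%:R * (#|G|%:R * sct_sigma X x).
  move=> SX SY.
  transitivity (\sum_(i in X) \sum_(j in Y) 'chi_i 1%g * 'chi_j 1%g
                   * \sum_(y in G) 'chi_i y * 'chi_j (y^-1 * x)%g).
    rewrite /sct_sigma; under eq_bigr => y _.
      rewrite !sum_cfunE mulr_suml.
      under eq_bigr => i _ do rewrite mulr_sumr.
      over.
    rewrite exchange_big; apply: eq_bigr => i _.
    rewrite exchange_big; apply: eq_bigr => j _.
    rewrite mulr_sumr; apply: eq_bigr => y _.
    by rewrite !cfunE mulrACA.
  have [<-{Y SY} | neXY] := eqVneq.
    rewrite mul1r /sct_sigma sum_cfunE mulr_sumr; apply: eq_bigr => i Xi.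
    rewrite (bigD1 i) //= [Z in _ + Z]big1 ?addr0 => [|j /andP[_ ne_ji]].
      rewrite irr_convolution eqxx mul1r cfunE mulrCA.
      by rewrite -mulrA [_ * (_ / _)]mulrC mulfVK ?irr1_neq0.
    by rewrite irr_convolution eq_sym (negPf ne_ji) mul0r mulr0.
  rewrite mul0r big1 // => i Xi; rewrite big1 // => j Yj.
  rewrite irr_convolution; case: eqP => [ij | _]; last by rewrite mul0r mulr0.
  case/and3P: (sct_chars_partition sctS) => _ tiX _.
  case/eqP: neXY; rewrite -(def_pblock tiX SX Xi).
  by rewrite (def_pblock tiX SY) // ij.
have conv x : x \in G -> \sum_(y in G) f y * g (y^-1 * x)%g
    = \sum_(X in sct_chars S) a X * b X * (#|G|%:R * sct_sigma X x).
  move=> Gx; transitivity (\sum_(X in sct_chars S) \sum_(Y in sct_chars S)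
     a X * b Y * \sum_(y in G) sct_sigma X y * sct_sigma Y (y^-1 * x)%g).
    under eq_bigr => y Gy.
      rewrite def_f // def_g ?groupM ?groupV // mulr_suml.
      under eq_bigr => X _ do rewrite mulr_sumr.
      over.
    rewrite exchange_big; apply: eq_bigr => X _.
    rewrite exchange_big; apply: eq_bigr => Y _.
    by rewrite mulr_sumr; apply: eq_bigr => y _; rewrite mulrACA.
  apply: eq_bigr => X SX; rewrite (bigD1 X) //= [Z in _ + Z]big1 ?addr0.
    by rewrite sigma_conv // eqxx mul1r.
  move=> Y /andP[SY neYX].
  by rewrite sigma_conv // eq_sym (negPf neYX) mul0r mulr0.
move=> x Gx y Kxy; rewrite !conv // ?(subsetP (sct_cl_sub sctS x)) //.
apply: eq_bigr => X SX; congr (_ * (_ * _)).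
exact: (sct_sigma_invariant sctS SX).
Qed.

(** Closed sets are the unions of S-classes, that is, the subsets of G whose
    indicator is constant on S-classes. *)
Definition sct_closed (A : {set gT}) :=
  A \subset G /\ {in A, forall x, sct_cl S x \subset A}.

Lemma sct_closed_mem (A : {set gT}) x y :
  sct_closed A -> y \in sct_cl S x -> (y \in A) = (x \in A).
Proof.
move=> [sAG clA] Kxy; apply/idP/idP=> [Ay | Ax]; last first.
  exact: subsetP (clA x Ax) y Kxy.
apply: (subsetP (clA y Ay)); rewrite (sct_cl_eq sctS Kxy) (mem_sct_cl sctS).
apply: contraLR Kxy => G'x.
suff ->: sct_cl S x = set0 by rewrite inE.
rewrite /sct_cl /pblock; case: pickP => [K /andP[SK Kx] | //].
by rewrite (subsetP (sct_class_sub sctS SK)) in G'x.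
Qed.

Lemma sct_closed_invariant (A : {set gT}) :
  sct_closed A -> sct_invariant S (fun x => (x \in A)%:R).
Proof. by move=> clA x _ y Kxy; rewrite (sct_closed_mem clA Kxy). Qed.

Lemma sct_cl_closed x : sct_closed (sct_cl S x).
Proof.
split=> [|y Kxy]; first exact: sct_cl_sub.
by rewrite (sct_cl_eq sctS Kxy).
Qed.

(** The number of factorizations x = a b with a in A and b in B is the
    convolution at x of the indicators of A and B. *)
Lemma sct_mul_count (A B : {set gT}) x y :
    sct_closed A -> sct_closed B -> x \in G -> y \in sct_cl S x ->
  #|[set a in A | (a^-1 * y)%g \in B]| = #|[set a in A | (a^-1 * x)%g \in B]|.
Proof.
move=> clA clB Gx Kxy; apply/eqP; rewrite -(eqr_nat algC); apply/eqP.
have count z : #|[set a in A | (a^-1 * z)%g \in B]|%:R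
    = \sum_(a in G) (a \in A)%:R * ((a^-1 * z)%g \in B)%:R :> algC.
  have [sAG _] := clA.
  rewrite -sum1_card natr_sum big_mkcond [RHS]big_mkcond.
  apply: eq_bigr => a _; rewrite inE.
  have [/(subsetP sAG)-> | _] := boolP (a \in A).
    by case: (_ \in B); rewrite ?mulr1 ?mulr0.
  by rewrite mul0r if_same.
rewrite !count.
have inv := sct_invariant_convolution (sct_closed_invariant clA)
  (sct_closed_invariant clB).
exact: inv Gx y Kxy.
Qed.

Lemma sct_closedM (A B : {set gT}) :
  sct_closed A -> sct_closed B -> sct_closed (A * B)%g.
Proof.
move=> clA clB; have [sAG _] := clA; have [sBG _] := clB.
split=> [|_ /mulsgP[a b Aa Bb ->]]; first by rewrite mul_subG.
apply/subsetP => y Ky; have Gab: (a * b)%g \in G.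
  exact: groupM (subsetP sAG a Aa) (subsetP sBG b Bb).
have: (0 < #|[set c in A | (c^-1 * y)%g \in B]|)%N.
  rewrite (sct_mul_count clA clB Gab Ky); apply/card_gt0P; exists a.
  by rewrite inE Aa mulKg Bb.
case/card_gt0P => c; rewrite inE => /andP[Ac Bc].
by apply/mulsgP; exists c (c^-1 * y)%g; rewrite ?mulKVg.
Qed.

Lemma sct_closed_norm (N : {group gT}) : sct_closed N -> N <| G.
Proof.
move=> clN; have [sNG _] := clN; rewrite /normal sNG; apply/normsP => x Gx.
apply/eqP; rewrite eqEcard cardJg leqnn andbT; apply/subsetP => _ /imsetP[y Ny ->].
by rewrite (sct_closed_mem clN (sct_cl_conj sctS (subsetP sNG y Ny) Gx)).
Qed.

Lemma sct_normalP (N : {group gT}) : sct_normal S N <-> sct_closed N.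
Proof.
split=> [[P sPS ->] | clN].
  split=> [|x /bigcupP[K PK Kx]].
    by apply/bigcupsP => K /(subsetP sPS); apply: sct_class_sub.
  by rewrite (sct_cl_def sctS _ Kx) ?(subsetP sPS) //; apply: (bigcup_max K).
have [sNG cl] := clN; exists [set sct_cl S x | x in N].
  by apply/subsetP => _ /imsetP[x /(subsetP sNG) Gx ->]; apply: sct_cl_mem.
apply/setP => x; apply/idP/bigcupP => [Nx | [_ /imsetP[y Ny ->] Kyx]].
  by exists (sct_cl S x); rewrite ?imset_f // (mem_sct_cl sctS) (subsetP sNG).
exact: subsetP (cl y Ny) x Kyx.
Qed.

(** The sets K N, for K an S-class, thus partition G: they are the preimages of
    the parts of the quotient theory. *)
Lemma sct_mul_block (N : {group gT}) x y :
    sct_closed N -> x \in G -> y \in (sct_cl S x * N)%g ->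
  (sct_cl S y * N)%g = (sct_cl S x * N)%g.
Proof.
move=> clN.
have sub u v : v \in (sct_cl S u * N)%g -> (sct_cl S v * N \subset sct_cl S u * N)%g.
  have [_ clKN] := sct_closedM (sct_cl_closed u) clN.
  move=> /clKN sKv; apply: subset_trans (mulSg N sKv) _.
  by rewrite -mulgA mulGid.
move=> Gx KNy; apply/eqP; rewrite eqEsubset sub //=; apply: sub.
have /mulsgP[k n Kk Nn def_y] := KNy.
have: k \in (sct_cl S y * N)%g.
  apply/mulsgP; exists y n^-1%g; rewrite ?groupV ?def_y ?mulgK //.
  have [sNG _] := clN; rewrite (mem_sct_cl sctS).
  exact: groupM (subsetP (sct_cl_sub sctS x) k Kk) (subsetP sNG n Nn).
rewrite (sct_closed_mem (sct_closedM (sct_cl_closed y) clN) Kk).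
by [].
Qed.

End ClosedSets.
(** * Central series *)

Section CentralSeries.

Local Open Scope group_scope.

(** Count in two ways the pairs (a, y) with a in A and y in a N: the hypothesis
    says that A meets every coset of N inside A N in c points. *)
Lemma card_mulg_lcoset (gT : finGroupType) (A : {set gT}) (N : {group gT}) c :
    {in A, forall x, #|A :&: x *: N| = c} -> (#|A * N|%g * c = #|A| * #|N|)%N.
Proof.
move=> cA.
transitivity (\sum_(y in (A * N)%g) \sum_(a in A | a \in y *: N) 1)%N.
  rewrite -sum_nat_const; apply: eq_bigr => _ /mulsgP[x n Ax Nn ->].
  rewrite -(cA x Ax) -sum1_card; apply: eq_bigl => a.
  by rewrite inE lcosetM (lcoset_id Nn).
rewrite (exchange_big_dep (mem A)) //= => [|y a _ /andP[]//].
rewrite -sum_nat_const; apply: eq_bigr => a Aa.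
rewrite -(card_lcoset N a) -sum1_card; apply: eq_bigl => y.
rewrite Aa [in LHS]lcoset_sym andb_idl // => /lcosetP[n Nn ->].
exact: mem_mulg.
Qed.

Variables (gT : finGroupType) (G : {group gT}) (S : supertheory_data G).
Hypothesis sctS : is_supertheory S.

(** The preimage in G of the center of the theory induced on G / N, for N closed
    (see [sub_sct_center_quotient]). *)
Definition sct_center_mod (N : {group gT}) : {set gT} :=
  [set x in G | sct_cl S x \subset (x *: N)].

Lemma sct_quotient_cl (N : {group gT}) x : sct_closed S N -> x \in G ->
  sct_cl (sct_quotient S N) (coset N x) = (sct_cl S x / N).
Proof.
move=> clN Gx; have /andP[sNG nNG] := sct_closed_norm sctS clN.
have cl_eq y z : y \in G -> z \in G -> coset N y = coset N z ->
    (sct_cl S y / N) = (sct_cl S z / N).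
  move=> Gy Gz eq_yz.
  rewrite -(quotientMidr N (sct_cl S y)) -(quotientMidr N (sct_cl S z)).
  rewrite (@sct_mul_block _ _ S sctS N z y) //.
  have: y \in N :* z.
    by apply/rcoset_kercosetP; rewrite // (subsetP nNG).
  rewrite norm_rlcoset ?(subsetP nNG) // => /lcosetP[n Nn ->].
  by rewrite mem_mulg // (mem_sct_cl sctS).
have Qx: (sct_cl S x / N) \in sct_classes (sct_quotient S N).
  by apply: imset_f; apply: sct_cl_mem.
apply: def_pblock Qx _; last first.
  apply/morphimP; exists x; rewrite ?(subsetP nNG) ?(mem_sct_cl sctS) //.
apply/trivIsetP => _ _ /imsetP[K SK ->] /imsetP[L SL ->].
apply: contraR; rewrite -setI_eq0 => /set0Pn[u /setIP[]].
case/morphimP=> y _ Ky ->{u} /morphimP[z _ Lz] /cl_eq.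
rewrite (sct_cl_def sctS SK Ky) (sct_cl_def sctS SL Lz) => -> //.
  exact: subsetP (sct_class_sub sctS SK) y Ky.
exact: subsetP (sct_class_sub sctS SL) z Lz.
Qed.

Lemma sub_sct_center_quotient (N H : {group gT}) :
    sct_closed S N -> H \subset G ->
  ((H / N) \subset sct_center (sct_quotient S N))
    = (H \subset sct_center_mod N).
Proof.
move=> clN sHG; have /andP[sNG nNG] := sct_closed_norm sctS clN.
have cl1 x : x \in G -> (coset N x \in sct_center (sct_quotient S N))
                          = (x \in sct_center_mod N).
  move=> Gx; have nNx := subsetP nNG x Gx.
  rewrite !inE mem_quotient ?Gx //= sct_quotient_cl //.
  have Kx: coset N x \in (sct_cl S x / N).
    by apply/morphimP; exists x; rewrite ?(mem_sct_cl sctS).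
  transitivity ((sct_cl S x / N) == [set coset N x]).
    apply/cards1P/eqP=> [[u def_u] | ->]; last by exists (coset N x).
    by move: Kx; rewrite def_u => /set1P->.
  rewrite eqEsubset sub1set Kx andbT -quotient_set1 // quotientSK //.
    by rewrite norm_rlcoset.
  exact: subset_trans (sct_cl_sub sctS x) nNG.
apply/subsetP/subsetP=> [sHZ x Hx | sHZ _ /morphimP[x _ Hx ->]].
  by rewrite -cl1 ?(subsetP sHG) // sHZ ?mem_quotient.
by rewrite cl1 ?(subsetP sHG) // sHZ.
Qed.

Lemma sct_center_mod_closed (N : {group gT}) :
  sct_closed S (sct_center_mod N).
Proof.
split=> [|x]; first by apply/subsetP => x; rewrite inE => /andP[].
rewrite inE => /andP[Gx sKx]; apply/subsetP => y Kxy.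
rewrite inE (subsetP (sct_cl_sub sctS x)) //= (sct_cl_eq sctS Kxy).
by have /lcosetP[n Nn ->] := subsetP sKx y Kxy; rewrite lcosetM lcoset_id.
Qed.

Lemma lcoset_center_mod (N : {group gT}) x :
  sct_closed S N -> x \in sct_center_mod N -> (x *: N) = (sct_cl S x * N).
Proof.
move=> clN; rewrite inE => /andP[Gx sKx]; apply/eqP; rewrite eqEsubset.
rewrite mulSg ?sub1set ?(mem_sct_cl sctS) //=.
by apply: subset_trans (mulSg N sKx) _; rewrite -mulgA mulGid.
Qed.

(** Cosets of N by elements x and y of this set are the products K N for the
    S-classes K of x and y, so that their product x y N is closed, and contains
    the S-class of x y. *)
Lemma sct_center_mod_group_set (N : {group gT}) :
  sct_closed S N -> group_set (sct_center_mod N).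
Proof.
move=> clN; have /andP[sNG nNG] := sct_closed_norm sctS clN.
apply/group_setP; split=> [|x y Zx Zy].
  by rewrite inE group1 sct_cl1 // sub1set mul1g group1.
have [[Gx _] [Gy _]] := (setIdP Zx, setIdP Zy).
rewrite inE groupM //=.
have defxyN: ((x * y) *: N = (sct_cl S x * N) * (sct_cl S y * N)).
  rewrite -!lcoset_center_mod // lcosetM -[in RHS]mulgA; congr (_ * _).
  by rewrite mulgA norm_rlcoset ?(subsetP nNG) // -mulgA mulGid.
have clxy: sct_closed S ((x * y) *: N).
  by rewrite defxyN; do !apply: sct_closedM => //; apply: sct_cl_closed.
by have [_ ->] := clxy; rewrite ?lcoset_refl.
Qed.

Lemma sct_mul_coset_count (N : {group gT}) x : sct_closed S N -> x \in G ->
  (#|sct_cl S x * N|%g * #|sct_cl S x :&: x *: N| = #|sct_cl S x| * #|N|)%N.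
Proof.
move=> clN Gx; apply: card_mulg_lcoset => y Kxy.
have countE z : #|sct_cl S x :&: z *: N|
   = #|[set a in sct_cl S x | (a^-1 * z) \in N]|.
  by apply: eq_card => a; rewrite !inE -mem_lcoset lcoset_sym.
by rewrite !countE; apply: (sct_mul_count sctS (sct_cl_closed sctS x) clN Gx).
Qed.

Lemma sub_center_mod (N : {group gT}) :
  sct_closed S N -> N \subset sct_center_mod N.
Proof.
move=> [sNG clN]; apply/subsetP => x Nx.
by rewrite inE (subsetP sNG) // lcoset_id // clN.
Qed.

(** The analogue of the nontriviality of the center of a p-group. The sets K N
    partition G, have p-power size, and those of size |N| are the cosets making
    up the center modulo N. If N were the only one of them, all the others, as
    well as |G|, would be multiples of p |N|, which |N| is not. *)
Lemma center_mod_proper (p : nat) (N : {group gT}) :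
    prime p -> p.-group G -> {in G, forall x, p.-nat #|sct_cl S x|} ->
    sct_closed S N -> N != G :> {set gT} -> N \proper sct_center_mod N.
Proof.
move=> p_pr pG pK clN neqNG; have [sNG _] := clN.
rewrite properE sub_center_mod //=; apply/negP => sZN.
pose P := [set sct_cl S x * N | x in G].
have xB x : x \in G -> x \in sct_cl S x * N.
  by move=> Gx; rewrite -{1}[x]mulg1 mem_mulg // (mem_sct_cl sctS).
have partP : partition P G.
  apply/and3P; split.
  - apply/eqP/setP => x; apply/bigcupP/idP => [[_ /imsetP[y Gy ->]] | Gx].
      by apply/subsetP; rewrite mul_subG ?(sct_cl_sub sctS).
    by exists (sct_cl S x * N); [apply: imset_f | apply: xB].
  - apply/trivIsetP => _ _ /imsetP[x Gx ->] /imsetP[y Gy ->].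
    apply: contraR; rewrite -setI_eq0 => /set0Pn[z /setIP[]].
    by move=> /(sct_mul_block sctS clN Gx)<- /(sct_mul_block sctS clN Gy)<-.
  by apply/imsetP => -[x Gx /setP/(_ x)]; rewrite inE xB.
have [k oN] := p_natP (pgroupS sNG pG).
have [m oG] := p_natP pG.
have p_gt1 := prime_gt1 p_pr.
have ltkm: (k < m)%N.
  rewrite -(ltn_exp2l _ _ p_gt1) -oN -oG; apply: proper_card.
  by rewrite properEneq neqNG sNG.
have PN: (N : {set gT}) \in P.
  by apply/imsetP; exists 1; rewrite ?group1 // sct_cl1 // mul1g.
have dvdB (B : {set gT}) : B \in P -> B != N -> (p ^ k.+1 %| #|B|)%N.
  case/imsetP=> x Gx ->{B} neqBN.
  have [j oB]: {j : nat | #|sct_cl S x * N|%g = (p ^ j)%N}.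
    apply: p_natP.
    have pKN: p.-nat (#|sct_cl S x| * #|N|)%N.
      by rewrite pnatM pK //; apply: pgroupS sNG pG.
    by apply: pnat_dvd pKN; rewrite -(sct_mul_coset_count clN Gx) dvdn_mulr.
  rewrite oB dvdn_Pexp2l // -(ltn_exp2l _ _ p_gt1) -oB -oN ltnNge.
  apply: contra neqBN => leBN.
  have sxB: x *: N \subset sct_cl S x * N.
    by rewrite mulSg // sub1set (mem_sct_cl sctS).
  have defB: x *: N = sct_cl S x * N.
    by apply/eqP; rewrite eqEcard sxB card_lcoset.
  have Nx: x \in N.
    apply: (subsetP sZN); rewrite inE Gx defB /=.
    exact: mulG_subl.
  by rewrite -defB lcoset_id.
have := card_partition partP; rewrite (bigD1 (N : {set gT})) //= => defG.
have dvdG: (p ^ k.+1 %| #|G|)%N by rewrite oG dvdn_Pexp2l.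
have: (p ^ k.+1 %| #|N|)%N.
  have dvdS: (p ^ k.+1 %| \sum_(B in P | B != N) #|B|)%N.
    by apply: dvdn_sum => B /andP[PB neqBN]; apply: dvdB.
  by rewrite -(dvdn_addl _ dvdS) -defG.
by rewrite oN dvdn_Pexp2l // ltnn.
Qed.

(** The upper central series, iterated from 1, grows strictly until it reaches
    G, hence is at G after |G| steps. *)
Lemma sct_nilpotent_of_pnat_cl (p : nat) :
    prime p -> p.-group G -> {in G, forall x, p.-nat #|sct_cl S x|} ->
  sct_nilpotent S.
Proof.
move=> p_pr pG pK.
pose U i := iter i (fun N : {group gT} => <<sct_center_mod N>>%G) 1%G.
have Uclosed i : sct_closed S (U i).
  elim: i => [|i IHi] /=.
    split=> [|x /set1P->]; first exact: sub1G.
    by rewrite sct_cl1.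
  by rewrite (gen_set_id (sct_center_mod_group_set IHi)); apply: sct_center_mod_closed.
have US i : U i.+1 = sct_center_mod (U i) :> {set gT}.
  by rewrite /= gen_set_id // sct_center_mod_group_set.
have Ugrow i : (i < #|U i|)%N || (U i == G :> {set gT}).
  elim: i => [|i IHi]; first by rewrite cards1.
  have [UiG | neqUG] := eqVneq (U i : {set gT}) G.
    apply/orP; right; rewrite eqEsubset; have [-> _] := Uclosed i.+1.
    by rewrite US -{1}UiG sub_center_mod.
  rewrite (negPf neqUG) orbF in IHi; rewrite US (leq_ltn_trans IHi) //.
  exact/proper_card/(center_mod_proper p_pr pG pK).
pose r := #|G|; exists r, (fun i => U (r.+1 - i)%N); split.
- apply/group_inj; rewrite subSS subn0; apply/eqP.
  have := Ugrow r; rewrite ltnNge subset_leq_card //.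
  by have [] := Uclosed r.
- by rewrite subnn.
- by move=> i _; apply/sct_normalP.
move=> i /andP[_ leir]; rewrite subSS subSn //.
have [sUG _] := Uclosed (r - i).+1.
rewrite (sub_sct_center_quotient (Uclosed _)) // -US subxx.
by rewrite US sub_center_mod.
Qed.

(** It suffices that every |K N_i| be a power of p, by induction along the
    series. For M = N_i and L = N_(i+1), the set A = K L meets every y M, y in
    A, in y T where T is the stabiliser of A in M under right translation:
    for n in M the translate A n = K (n L) is closed, because n L is, so that
    A n contains, and therefore equals, A as soon as it meets A. *)
Lemma pnat_cl_of_sct_nilpotent (p : nat) :
    p.-group G -> sct_nilpotent S -> {in G, forall x, p.-nat #|sct_cl S x|}.
Proof.
move=> pG [r [N [N1 Nr normN centN]]] x Gx.
have clN i : (1 <= i <= r.+1)%N -> sct_closed S (N i).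
  by move/normN/(sct_normalP sctS).
suff: p.-nat #|sct_cl S x * N r.+1| by rewrite Nr mulg1.
suff H i : (i <= r)%N -> p.-nat #|sct_cl S x * N i.+1| by apply: H.
elim: i => [_ | i IHi lt_ir].
  rewrite N1; have ->: sct_cl S x * G = G :> {set gT}; last exact: pG.
  apply/eqP; rewrite eqEsubset mul_subG ?(sct_cl_sub sctS) //=.
  by rewrite -{1}(lcoset_id Gx) mulSg // sub1set (mem_sct_cl sctS).
have {IHi} pB := IHi (ltnW lt_ir).
set M := N i.+1 in pB; set L := N i.+2.
have clM: sct_closed S M by apply: clN; rewrite /= ltnS ltnW.
have clL: sct_closed S L by apply: clN.
have [sLM] : L \subset M /\ (M / L) \subset sct_center (sct_quotient S L).
  exact: centN.
have [sMG _] := clM.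
rewrite (sub_sct_center_quotient clL) // => sMZ.
have /andP[sLG nLG] := sct_closed_norm sctS clL.
pose A := sct_cl S x * L.
have clA: sct_closed S A by apply: sct_closedM => //; apply: sct_cl_closed.
pose T := 'C_M[A | 'Rs].
have cosetA y : y \in A -> A :&: y *: M = y *: T.
  move=> Ay; have Gy: y \in G by apply: subsetP y Ay; case: clA.
  apply/setP => z; apply/setIP/lcosetP => [[Az] | [t]].
    case/lcosetP=> n Mn def_z; exists n => //; rewrite inE Mn /=.
    apply/astab1P; rewrite /= rcosetE; apply/eqP; rewrite eq_sym eqEcard card_rcoset leqnn andbT.
    have Zn: n \in sct_center_mod L by apply: subsetP sMZ n Mn.
    have clAn: sct_closed S (A * (n *: L)).
      apply: sct_closedM => //; rewrite lcoset_center_mod //.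
      by apply: sct_closedM => //; apply: sct_cl_closed.
    have defAn: A * (n *: L) = A :* n.
      rewrite -norm_rlcoset; last first.
        exact: subsetP nLG n (subsetP sMG n Mn).
      by rewrite mulgA /A -(mulgA _ L L) mulGid.
    rewrite defAn in clAn.
    have Anz: z \in A :* n by rewrite def_z mem_mulg ?set11.
    have sKAn: sct_cl S z \subset A :* n by have [_ ->] := clAn.
    rewrite {1}/A -(sct_mul_block sctS clL Gx Az).
    apply: subset_trans (mulSg L sKAn) _; rewrite -defAn -!mulgA.
    by rewrite mulGid.
  case/setIP=> Mt /astab1P; rewrite /= rcosetE => At ->; split; last by rewrite mem_mulg ?set11.
  by rewrite -At mem_mulg ?set11.
have AM: A * M = sct_cl S x * M by rewrite /A -mulgA (mulSGid sLM).
have := @card_mulg_lcoset _ A M #|T| _.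
rewrite AM => cardA; have pM: p.-nat (#|A| * #|M|)%N.
  rewrite -cardA => [|y Ay]; last by rewrite cosetA // card_lcoset.
  rewrite pnatM pB; apply: pgroupS pG.
  by apply: subset_trans sMG; apply: subsetIl.
by move: pM; rewrite pnatM => /andP[].
Qed.

End CentralSeries.

(** * The equivalence *)

Lemma dvdn_pnat_leq (p k n : nat) :
  prime p -> p.-nat k -> p.-nat n -> (k <= n)%N -> (k %| n)%N.
Proof.
move=> p_pr /p_natP[a ->] /p_natP[b ->].
by rewrite leq_exp2l ?prime_gt1 // => /dvdn_exp2l->.
Qed.

Lemma sct_sigma1_leq (gT : finGroupType) (G : {group gT}) (X : {set Iirr G}) :
  sct_sigma X 1%g <= #|G|%:R.
Proof.
rewrite -irr_sum_square /sct_sigma sum_cfunE big_mkcond /=.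
apply: ler_sum => i _; case: ifP => _; last exact/exprn_ge0/char1_ge0/irr_char.
by rewrite cfunE expr2.
Qed.

Theorem theorem3 (p : nat) (gT : finGroupType) (G : {group gT})
    (S : supertheory_data G)
    (p_prime : prime p) (pG : p.-group G) (sctS : is_supertheory S) :
  [<-> sct_nilpotent S;
       forall chi : 'CF(G), chi \in sct_Ch S -> (chi 1%g %| #|G|)%C;
       forall g : gT, g \in G -> (#|sct_cl S g| %| #|G|)%N].
Proof.
pose m (X : {set Iirr G}) := Num.truncn (sct_sigma X 1%g).
have mE X : sct_sigma X 1%g = (m X)%:R.
  by rewrite truncnK // Cnat_char1 ?sct_sigma_char.
have prodm : \prod_(X in sct_chars S) sct_sigma X 1%g
               = (\prod_(X in sct_chars S) m X)%N%:R.
  by rewrite natr_prod; apply: eq_bigr => X _.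
have prodK : \prod_(K in sct_classes S) #|K|%:R
               = (\prod_(K in sct_classes S) #|K|)%N%:R :> algC.
  by rewrite natr_prod.
have dvdK := sct_prod_class_dvd sctS.
have dvdm := sct_prod_degree_dvd sctS.
rewrite prodK prodm -natrX -natrM dvdC_nat in dvdK.
rewrite prodK prodm -natrX -natrM dvdC_nat in dvdm.
have pGd : p.-nat (#|G| ^ #|sct_classes S|)%N by rewrite pnatX [p.-nat _]pG.
have p_prod (I : finType) (A : {set I}) (F : I -> nat) :
    p.-nat (\prod_(i in A) F i)%N <-> {in A, forall i, p.-nat (F i)}.
  split=> [pF i Ai | pF].
    by apply: pnat_dvd pF; rewrite (bigD1 i) //= dvdn_mulr.
  by apply: (big_ind (fun k => p.-nat k)) => // a b pa pb; rewrite pnatM pa.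
have le_mG X : (m X <= #|G|)%N by rewrite -(ler_nat algC) -mE sct_sigma1_leq.
tfae.
- move/(pnat_cl_of_sct_nilpotent sctS pG) => pK _ /mapP[X + ->].
  rewrite mem_enum mE dvdC_nat => SX.
  apply: (dvdn_pnat_leq p_prime) => //.
  suff /p_prod pm : p.-nat (\prod_(Y in sct_chars S) m Y)%N by apply: pm.
  apply: pnat_dvd dvdm _; rewrite pnatM pGd /=; apply/p_prod => K SK.
  have Kr := sct_class_repr sctS SK; rewrite -(sct_cl_def sctS SK Kr) pK //.
  exact: subsetP (sct_class_sub sctS SK) _ Kr.
- move=> dvd_m g Gg; apply: (dvdn_pnat_leq p_prime) => //; last first.
    exact/subset_leq_card/sct_cl_sub.
  suff /p_prod pK : p.-nat (\prod_(K in sct_classes S) #|K|)%N.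
    exact/pK/sct_cl_mem.
  apply: pnat_dvd dvdK _; rewrite pnatM pGd /=; apply/p_prod => X SX.
  apply: pnat_dvd pG; have := dvd_m (sct_sigma X).
  by rewrite mE dvdC_nat; apply; rewrite map_f ?mem_enum.
move=> dvd_cl; apply: (sct_nilpotent_of_pnat_cl sctS p_prime pG) => x Gx.
exact: pnat_dvd (dvd_cl x Gx) pG.
Qed.
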